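(* Let $(T,d)$ be a compact real tree. Then $\ell_T(T)$ is a finite quantity if and only if there exists a height function $h\in\mathcal{H}$ with bounded variation such that $(T,d)$ and $(T_h,d_h)$ are isometric. (Notation defined in the context.)
   Context: A real tree is a metric space $(T,d)$ in which any two points $\sigma,\sigma'$ are joined by a path isometric to $[0,d(\sigma,\sigma')]$, with image denoted $[\![\sigma,\sigma']\!]$, and such that every continuous injective $q:[0,1]\to T$ has image $[\![q(0),q(1)]\!]$. Write $]\!]\sigma,\sigma'[\![\,=[\![\sigma,\sigma']\!]\setminus\{\sigma,\sigma'\}$. **Length measure.** Fix a root $\rho\in T$ (its choice is irrelevant below). Let $\mathrm{Lf}(T)$ be the set of $\sigma\in T\setminus\{\rho\}$ such that $T\setminus\{\sigma\}$ is connected, and $\mathrm{Sk}(T)=T\setminus\mathrm{Lf}(T)$. The length measure $\ell_T$ is the measure on the trace on $\mathrm{Sk}(T)$ of the Borel sigma-field of $T$ characterized by $\ell_T(]\!]\sigma,\sigma'[\![)=d(\sigma,\sigma')$ for all $\sigma,\sigma'\in T$; $\ell_T(T)$ denotes its total mass $\ell_T(\mathrm{Sk}(T))\in[0,\infty]$. **Height functions.** For $M\geq 0$, $\mathcal{H}_M$ is the set of non-negative functions $h$ on $[0,M]$ that are left-continuous with right-limits and satisfy $h(0)=h(0+)=0$ and $h(t)-h(t+)\geq 0$ for $t\in[0,M)$ (conditions on right-limits are void if $M=0$); $\mathcal{H}=\bigcup_{M\ge 0}\mathcal{H}_M$. A function $h\in\mathcal{H}_M$ has bounded variation if $\sup\sum_{1\leq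 i\leq n}|h(t_i)-h(t_{i-1})|<\infty$, the supremum being over all subdivisions $0=t_0<t_1<\dots<t_n=M$. **Coding.** For $h\in\mathcal{H}_M$ and $s,t\in[0,M]$ set $d_h(s,t)=h(s)+h(t)-2\inf_{r\in[s\wedge t,s\vee t]}h(r)$ (a pseudo-distance). Let $s\sim_h t$ iff $d_h(s,t)=0$, and $T_h=[0,M]/\sim_h$ with the induced distance, still denoted $d_h$. *)

(* Defs.v *)
From HB Require Import structures.
From mathcomp Require Import all_boot all_order all_algebra.
From mathcomp Require Import all_classical all_reals all_analysis.
From mathcomp Require Import ring lra.

Set Implicit Arguments.
Unset Strict Implicit.
Unset Printing Implicit Defensive.

Import Order.TTheory GRing.Theory Num.Theory.
Import numFieldNormedType.Exports.

Local Open Scope classical_set_scope.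
Local Open Scope ring_scope.
Local Open Scope quotient_scope.

Section RealTree.
Context {R : realType} {T : metricType R}.
Implicit Types (x y z rho : T) (p q : R -> T).

(* The values of [p] outside [0, d(x, y)] are irrelevant; the same convention
   is used below for every function given on a compact interval. *)
Definition geodesic x y p : Prop :=
  [/\ p 0 = x, p (mdist x y) = y &
      {in `[0, mdist x y] &, forall s t, mdist (p s) (p t) = `|s - t|}].

(* Union of the images of all the geodesics from [x] to [y]. In a real tree all
   of them have the same image, as the second clause of [real_tree] applied to
   a rescaled geodesic shows. *)
Definition segment x y : set T :=
  \bigcup_(p in geodesic x y) (p @` `[0, mdist x y]).

Definition open_segment x y : set T := segment x y `\` [set x; y].

Definition leaves rho : set T :=
  [set x | x <> rho /\ connected (~` [set x])].

Definition skeleton rho : set T := ~` leaves rho.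

End RealTree.

Definition real_tree (R : realType) (T : metricType R) : Prop :=
  (forall x y : T, exists p, geodesic x y p) /\
  (forall q : R -> T, {within `[0, 1], continuous q} ->
     {in `[0, 1] &, injective q} -> q @` `[0, 1] = segment (q 0) (q 1)).

(* The skeleton as a measurable space: its sigma-algebra is the trace of the
   Borel sigma-algebra of [T]. *)
Section SkeletonSpace.
Context {R : realType} {T : metricType R} (rho : T).

Definition skeleton_space : Type := set_type (skeleton rho).

HB.instance Definition _ := Choice.on skeleton_space.

Definition skeleton_val (x : skeleton_space) : T := set_val x.

Lemma root_in_skeleton : rho \in skeleton rho.
Proof. by rewrite inE => -[]. Qed.

HB.instance Definition _ := isPointed.Build skeleton_space
  (exist _ rho root_in_skeleton : skeleton_space).

Definition trace_borel : set (set skeleton_space) :=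
  preimage_set_system setT skeleton_val <<s @open T >>.

Lemma trace_borel_sigma : sigma_algebra setT trace_borel.
Proof. exact/sigma_algebra_preimage/smallest_sigma_algebra. Qed.

Lemma trace_borel0 : trace_borel set0.
Proof. by case: trace_borel_sigma. Qed.

Lemma trace_borelC A : trace_borel A -> trace_borel (~` A).
Proof. by case: trace_borel_sigma => _ + _ => /[apply]; rewrite setTD. Qed.

Lemma trace_borelU (F : (set skeleton_space)^nat) :
  (forall i, trace_borel (F i)) -> trace_borel (\bigcup_i F i).
Proof. by case: trace_borel_sigma => _ _; apply. Qed.

HB.instance Definition _ := @isMeasurable.Build (sigma_display trace_borel)
  skeleton_space trace_borel trace_borel0 trace_borelC trace_borelU.

(* The values on open segments determine the measure away from the root only:
   when [rho] is an end point of the tree, [rho] lies in the skeleton but in no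
   open segment. The second clause fixes the mass of [rho], which is forced to
   be 0 whenever [rho] does lie in some open segment. *)
Definition is_length_measure (ell : {measure set skeleton_space -> \bar R}) :
    Prop :=
  (forall x y : T,
     ell (skeleton_val @^-1` open_segment x y) = (mdist x y)%:E) /\
  ell (skeleton_val @^-1` [set rho]) = 0%E.

End SkeletonSpace.

(* A height function together with the right end point of its domain
   [0, hf_bound]. *)
Record heightFun (R : realType) := HeightFun {
  hf_bound : R ;
  hf_fun :> R -> R ;
  hf_bound_ge0 : 0 <= hf_bound ;
  hf_ge0 : forall t : R, t \in `[0, hf_bound] -> 0 <= hf_fun t ;
  hf_left_continuous : forall t : R, t \in `]0, hf_bound] ->
    hf_fun r @[r --> t^'-] --> hf_fun t ;
  hf_right_limit : forall t : R, t \in `[0, hf_bound[ ->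
    cvg (hf_fun r @[r --> t^'+]) ;
  hf0 : hf_fun 0 = 0 ;
  hf0_right : 0 < hf_bound -> hf_fun r @[r --> 0^'+] --> (0 : R) ;
  hf_jump : forall t : R, t \in `[0, hf_bound[ ->
    0 <= hf_fun t - lim (hf_fun r @[r --> t^'+])
}.

Section Coding.
Context {R : realType}.

Definition coding_dist (h : R -> R) (s t : R) : R :=
  h s + h t - 2 * inf (h @` `[Num.min s t, Num.max s t]).

Variable h : heightFun R.

Definition coding_dom : Type := {r : R | r \in `[0, hf_bound h]}.

HB.instance Definition _ := Choice.on coding_dom.

Implicit Types s t u : coding_dom.

Definition coding_pdist s t : R := coding_dist h (val s) (val t).

Definition coding_itv s t : set R :=
  `[Num.min (val s) (val t), Num.max (val s) (val t)].

Lemma has_inf_coding_itv s t : has_inf (h @` coding_itv s t).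
Proof.
split.
  exists (h (val s)), (val s) => //.
  by rewrite /coding_itv /= in_itv /= ge_min le_max !lexx.
exists 0 => _ [r + <-]; rewrite /coding_itv /= in_itv /= => /andP[sr rt].
apply: hf_ge0; rewrite in_itv /=.
have /= := valP s; have /= := valP t; rewrite !in_itv /=.
move=> /andP[t0 tM] /andP[s0 sM].
rewrite (le_trans _ sr) ?le_min ?s0 ?t0//=.
by rewrite (le_trans rt)// ge_max sM tM.
Qed.

Lemma inf_coding_itv_le s t r :
  coding_itv s t r -> inf (h @` coding_itv s t) <= h r.
Proof.
move=> str; apply: ge_inf; last by exists r.
by case: (has_inf_coding_itv s t).
Qed.

Lemma coding_pdist_sym s t : coding_pdist s t = coding_pdist t s.
Proof.
by rewrite /coding_pdist /coding_dist minC maxC (addrC (h (val s))).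
Qed.

Lemma coding_pdistxx s : coding_pdist s s = 0.
Proof.
rewrite /coding_pdist /coding_dist minxx maxxx.
by rewrite set_itv1 image_set1 inf1; ring.
Qed.

Lemma coding_pdist_ge0 s t : 0 <= coding_pdist s t.
Proof.
rewrite /coding_pdist /coding_dist -/(coding_itv s t).
have := @inf_coding_itv_le s t (val s); have := @inf_coding_itv_le s t (val t).
rewrite /coding_itv /= !in_itv /= !ge_min !le_max !lexx !orbT /=.
move=> /(_ isT) ? /(_ isT) ?.
lra.
Qed.

Lemma coding_pdist_triangle t s u :
  coding_pdist s u <= coding_pdist s t + coding_pdist t u.
Proof.
rewrite /coding_pdist /coding_dist -/(coding_itv s t) -/(coding_itv t u).
rewrite -/(coding_itv s u).
have ht1 : inf (h @` coding_itv s t) <= h (val t).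
  apply: inf_coding_itv_le.
  by rewrite /coding_itv /= in_itv /= ge_min le_max !lexx !orbT.
have ht2 : inf (h @` coding_itv t u) <= h (val t).
  apply: inf_coding_itv_le.
  by rewrite /coding_itv /= in_itv /= ge_min le_max !lexx.
have hmin : Num.min (inf (h @` coding_itv s t)) (inf (h @` coding_itv t u))
    <= inf (h @` coding_itv s u).
  apply: lb_le_inf; first by case: (has_inf_coding_itv s u).
  move=> _ [r sur <-].
  have [str|tur] : coding_itv s t r \/ coding_itv t u r.
    move: sur; rewrite /coding_itv /= !in_itv /= !ge_min !le_max => /andP[].
    by case: (leP r (val t)) => [rt /orP[] -> _|/ltW tr _ /orP[] ->];
      rewrite ?rt ?tr ?orbT; [left|right|left|right].
  - by rewrite ge_min (inf_coding_itv_le str).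
  - by rewrite ge_min (inf_coding_itv_le tur) orbT.
by move: hmin; rewrite ge_min => /orP[]; lra.
Qed.

Definition coding_rel s t : bool := coding_pdist s t == 0.

Lemma coding_rel_equiv : equiv_class_of coding_rel.
Proof.
split=> [s|s t|t s u]; rewrite /coding_rel.
- by rewrite coding_pdistxx.
- by rewrite coding_pdist_sym.
- move=> /eqP st /eqP tu; rewrite eq_le coding_pdist_ge0 andbT.
  by rewrite (le_trans (coding_pdist_triangle t s u))// st tu addr0.
Qed.

Canonical coding_equiv := EquivRelPack coding_rel_equiv.

Definition coded_tree : Type := {eq_quot coding_equiv}.

HB.instance Definition _ := Choice.on coded_tree.
HB.instance Definition _ := Quotient.on coded_tree.

Definition coded_dist (x y : coded_tree) : R := coding_pdist (repr x) (repr y).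

Lemma coded_dist_pi s t :
  coded_dist (\pi_(coded_tree) s) (\pi_(coded_tree) t) = coding_pdist s t.
Proof.
have E v : coding_pdist (repr (\pi_(coded_tree) v)) v = 0.
  by apply/eqP; rewrite -/(coding_rel _ _); apply/eqmodP; rewrite reprK.
have := E s; have := E t; rewrite /coded_dist.
set t' := repr (\pi t); set s' := repr (\pi s) => t't s's.
apply/eqP; rewrite eq_le; apply/andP; split.
- have := coding_pdist_triangle s s' t'; have := coding_pdist_triangle t s t'.
  rewrite (coding_pdist_sym t t'); lra.
- have := coding_pdist_triangle s' s t; have := coding_pdist_triangle t' s' t.
  rewrite (coding_pdist_sym s s'); lra.
Qed.

Lemma coded_distxx x : coded_dist x x = 0.
Proof. exact: coding_pdistxx. Qed.

Lemma coded_dist_positivity x y : coded_dist x y = 0 -> x = y.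
Proof.
by move=> /eqP xy; rewrite -(reprK x) -(reprK y); apply/eqmodP.
Qed.

Lemma coded_dist_sym x y : coded_dist x y = coded_dist y x.
Proof. exact: coding_pdist_sym. Qed.

Lemma coded_dist_triangle y x z :
  coded_dist x z <= coded_dist x y + coded_dist y z.
Proof. exact: coding_pdist_triangle. Qed.

HB.instance Definition _ := isMetric.Build R coded_tree
  coded_distxx coded_dist_positivity coded_dist_sym coded_dist_triangle.

End Coding.

Definition isometric (R : realType) (T T' : metricType R) : Prop :=
  exists2 f : T -> T', bijective f &
    forall x y, mdist (f x) (f y) = mdist x y.

(* Main.v *)
Require Import Defs.
From mathcomp Require Import all_boot all_order all_algebra.
From mathcomp Require Import all_classical all_reals all_analysis.
From mathcomp Require Import ring lra.

Set Implicit Arguments.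
Unset Strict Implicit.
Unset Printing Implicit Defensive.

Import Order.TTheory GRing.Theory Num.Theory.
Import numFieldNormedType.Exports.

Local Open Scope classical_set_scope.
Local Open Scope ring_scope.

(** Both implications rest on a parametrization of the tree by an interval of
    times under which the distance of the tree becomes the coding distance of
    a height function; by [isometric_coded_treeP] this is the same thing as an
    isometry with a coded tree.

    Segments. In a real tree a segment is a metric interval ([segmentE]), and
    two segments that share nothing but an end point concatenate to a segment
    ([segment_glue]). Hence a nonempty compact convex subset has, for every point
    x, a gate: a point of the subset through which every segment from the
    subset to x passes ([gate_exists]).

    From finite length to a height function. The subtree spanned by the root
    and finitely many points is explored by a contour, a 1-Lipschitz closed
    path that walks along every branch twice, so that its duration is twice
    the length of the subtree. A further point x is reached by inserting, at a
    time when the path visits the gate of x, an excursion to x and back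
    ([contour_insert]); this adds to the subtree an open segment disjoint from
    it, and additivity of the length measure keeps the duration at most twice
    the length explored ([exploration_extend]). When the total length L is
    finite, all these contours live on [0, 2L]; being equi-Lipschitz with values
    in a compact space, they have a pointwise limit along an ultrafilter that
    contains, for every point of the tree, the set of the contours visiting it
    ([contour_limit]). The limit is onto, and its height is a Lipschitz height
    function that codes the tree.

    From a height function of bounded variation to finite length. The coding
    distance of two times is at most the total variation of h between them
    ([coding_dist_le_TV]), so the segments joining the points visited at the
    consecutive times of a grid have total length at most the variation of h.
    These segments need not cover the tree, but a point of the skeleton other
    than the root cuts the tree into two open parts. A fine grid visits both
    parts ([grid_dense]), and the chain of segments has to cross the cut
    ([cut_by_chain]). Every such point thus lies in the unions attached to all
    fine enough grids, and continuity of the measure bounds the length of the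
    skeleton by the variation of h ([measure_eventually_le]). *)

(** * Lipschitz maps into a metric space *)
Section MetricLipschitz.
Context {R : realType} {T : metricType R}.

Lemma lipschitz_within_continuous (k : R) (p : R -> T) (A : set R) :
  {in A &, forall s t, mdist (p s) (p t) <= k * `|s - t|} ->
  {within A, continuous p}.
Proof.
move=> plip; apply/subspace_continuousP => x Ax.
apply/metricType_numDomainType.cvgrPdist_lt => e e0.
have k0 : 0 < `|k| + 1 by rewrite ltr_wpDl.
rewrite near_withinE; near=> t => At.
rewrite (le_lt_trans (plip _ _ (mem_set Ax) (mem_set At)))//.
rewrite (@le_lt_trans _ _ ((`|k| + 1) * `|x - t|))//.
  by rewrite ler_wpM2r// (le_trans (ler_norm k))// lerDl.
rewrite -ltr_pdivlMl// mulrC.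
near: t; apply: (@cvgr_dist_lt _ _ _ (nbhs x) _ id) => //.
by rewrite divr_gt0.
Unshelve. all: by end_near. Qed.

Lemma mdist_continuous (x : T) : continuous (mdist x).
Proof.
move=> y; apply/cvgrPdist_lt => e e0.
have : \forall z \near y, mdist y z < e.
  by apply: (@metricType_numDomainType.cvgr_dist_lt _ _ _ (nbhs y) _ id).
apply: filterS => z yz; rewrite ltr_distlC.
have := metric_triangle x y z; have := metric_triangle x z y.
rewrite (metric_sym z y); lra.
Qed.

End MetricLipschitz.

(** * Segments of a real tree *)
Section RealTreeSegments.
Context {R : realType} {T : metricType R}.
Hypothesis T_tree : real_tree T.
Implicit Types (a b x y z : T).

(** The arc axiom, freed from the unit interval: this is the form in which it
    applies to a path parametrized by length. *)
Lemma lipschitz_arc (D : R) (g : R -> T) : 0 < D ->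
  {in `[0, D] &, forall s t, mdist (g s) (g t) <= `|s - t|} ->
  {in `[0, D] &, injective g} ->
  g @` `[0, D] = segment (g 0) (g D).
Proof.
move=> D0 glip ginj.
have sc t : (t * D \in `[0, D]) = (t \in `[0, 1]).
  by rewrite !in_itv/= pmulr_lge0// ger_pMl.
have [_ /(_ (fun t => g (t * D)))] := T_tree.
rewrite mul0r mul1r => <-.
- rewrite eqEsubset; split=> _ [t /= tD <-]; last first.
    by exists (t * D) => //=; rewrite sc.
  exists (t / D); last by rewrite divfK// gt_eqF.
  by rewrite /= -sc divfK// gt_eqF.
- apply: (@lipschitz_within_continuous _ _ D) => s t.
  rewrite !inE/= -!(sc _) => sD tD.
  by rewrite (le_trans (glip _ _ sD tD))// -mulrBl normrM (gtr0_norm D0) mulrC.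
- move=> s t; rewrite -!(sc _) => sD tD /(ginj _ _ sD tD).
  by apply: mulIf; rewrite gt_eqF.
Qed.

Lemma geodesic_image x y (p : R -> T) : geodesic x y p ->
  p @` `[0, mdist x y] = segment x y.
Proof.
move=> pg; have [p0 pD piso] := pg.
have := mdist_ge0 x y; rewrite le_eqVlt => /orP[/eqP xy0|xy0]; last first.
  rewrite -[in RHS]p0 -[in X in segment _ X]pD; apply: lipschitz_arc => //.
    by move=> s t sD tD; rewrite piso.
  move=> s t sD tD pst; apply/eqP; rewrite -subr_eq0 -normr_eq0 -piso//.
  by rewrite pst mdistxx.
rewrite eqEsubset; split; first by move=> z pz; exists p.
move=> _ [q [q0 _ _] [t + <-]]; rewrite -!xy0 set_itv1 image_set1/= p0 => ->.
by rewrite q0.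
Qed.

(** The betweenness relation of the metric: concatenating geodesics from [x]
    to [z] and from [z] to [y] gives a geodesic as soon as the lengths add
    up. *)
Lemma segmentE x y :
  segment x y = [set z | mdist x z + mdist z y = mdist x y].
Proof.
rewrite eqEsubset; split.
  move=> _ [p [p0 pD piso] [t /= tD <-]].
  have xyD : mdist x y \in `[0, mdist x y] by rewrite in_itv/= lexx mdist_ge0.
  have x0 : 0 \in `[0, mdist x y] by rewrite in_itv/= lexx mdist_ge0.
  have -> : mdist x (p t) = `|0 - t| by rewrite -piso// p0.
  have -> : mdist (p t) y = `|t - mdist x y| by rewrite -piso// pD.
  move: tD; rewrite in_itv/= => /andP[t0 tD].
  by rewrite sub0r normrN ger0_norm// distrC ger0_norm ?subr_ge0//; lra.
move=> z /= xzy.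
have [[p [p0 pD piso]] [q [q0 qD qiso]]] := (T_tree.1 x z, T_tree.1 z y).
pose g t := if t <= mdist x z then p t else q (t - mdist x z).
have xz0 := mdist_ge0 x z; have zy0 := mdist_ge0 z y.
have gz : g (mdist x z) = z by rewrite /g lexx.
exists g; last by exists (mdist x z) => //=; rewrite in_itv/= xz0/= -xzy lerDl.
have g0 : g 0 = x by rewrite /g mdist_ge0.
have gD : g (mdist x y) = y.
  rewrite /g -xzy gerDl; case: leP => [zy|_]; last by rewrite addrC addKr.
  have zyE : mdist z y = 0 by apply/eqP; rewrite eq_le zy.
  by rewrite zyE addr0 pD; exact: mdist_positivity.
have isoW s t : s \in `[0, mdist x y] -> t \in `[0, mdist x y] -> s <= t ->
    mdist (g s) (g t) = t - s.
  rewrite !in_itv/= -xzy => /andP[s0 sD] /andP[t0 tD] st.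
  have [tz|zt] := leP t (mdist x z).
    rewrite /g tz (le_trans st tz) piso ?in_itv/= ?t0 ?s0 ?(le_trans st)//.
    by rewrite distrC ger0_norm// subr_ge0.
  have qI u v : mdist x z <= u -> u <= v -> v <= mdist x z + mdist z y ->
      mdist (q (u - mdist x z)) (q (v - mdist x z)) = v - u.
    move=> zu uv vD; rewrite qiso ?in_itv/=; [|lra|lra].
    by rewrite distrC ger0_norm; lra.
  have [sz|zs] := leP s (mdist x z); last first.
    rewrite /g (lt_geF zs) (lt_geF zt) qI//; exact: ltW.
  have xzI : mdist x z \in `[0, mdist x z] by rewrite in_itv/= lexx xz0.
  have E1 : mdist (g s) z = mdist x z - s.
    rewrite -[in X in mdist _ X]pD /g sz piso ?in_itv/= ?s0 ?lexx ?xz0//.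
    by rewrite distrC ger0_norm// subr_ge0.
  have E2 : mdist z (g t) = t - mdist x z.
    have := qI (mdist x z) t (lexx _) (ltW zt) tD.
    by rewrite subrr q0 /g (lt_geF zt).
  have E3 : mdist x (g s) = s.
    rewrite -[in X in mdist X _]p0 /g sz piso ?in_itv/= ?s0 ?lexx ?xz0//.
    by rewrite sub0r normrN ger0_norm.
  have E4 : mdist (g t) y = mdist x z + mdist z y - t.
    have := qI t (mdist x z + mdist z y) (ltW zt) tD (lexx _).
    by rewrite addrAC subrr add0r qD /g (lt_geF zt).
  have := metric_triangle (g s) z (g t).
  have := metric_triangle x (g s) y; have := metric_triangle (g s) (g t) y.
  rewrite E1 E2 E3 E4 -xzy; lra.
split => // s t sD tD; case: (leP s t) => [st|/ltW ts].
- by rewrite isoW// distrC ger0_norm// subr_ge0.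
- by rewrite metric_sym isoW// ger0_norm// subr_ge0.
Qed.

Lemma closed_segment x y : closed (segment x y).
Proof.
rewrite segmentE.
have -> : [set z | mdist x z + mdist z y = mdist x y] =
    (fun z => mdist x z + mdist y z) @^-1` [set mdist x y].
  by apply/seteqP; split => z /=; rewrite (metric_sym z y).
apply: closed_comp; last exact: closed_eq.
by move=> z _; apply: cvgD; exact: mdist_continuous.
Qed.

Lemma connected_segment x y : connected (segment x y).
Proof.
have [p pg] := T_tree.1 x y; have [_ _ piso] := pg.
rewrite -(geodesic_image pg); apply: connected_continuous_connected.
  exact: segment_connected.
apply: (@lipschitz_within_continuous _ _ 1) => s t; rewrite !inE => sD tD.
by rewrite mul1r piso.
Qed.

Lemma segment_left x y : segment x y x.
Proof. by rewrite segmentE /= mdistxx add0r. Qed.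

Lemma segment_right x y : segment x y y.
Proof. by rewrite segmentE /= mdistxx addr0. Qed.

(** The concatenation of two geodesics that meet only at their common end point
    is injective, so the arc axiom makes it a parametrization of a segment. *)
Lemma segment_glue a y b :
  (forall z, segment a y z -> segment y b z -> z = y) -> segment a b y.
Proof.
move=> ayb.
have [[p pg] [q qg]] := (T_tree.1 a y, T_tree.1 y b).
have [p0 pD piso] := pg; have [q0 qD qiso] := qg.
have ay0 := mdist_ge0 a y; have yb0 := mdist_ge0 y b.
have [yb|yb] := leP (mdist y b) 0.
  suff -> : y = b by exact: segment_right.
  by apply: mdist_positivity; apply/eqP; rewrite eq_le yb.
have ayI : mdist a y \in `[0, mdist a y] by rewrite in_itv/= lexx ay0.
have ybI : 0 \in `[0, mdist y b] by rewrite in_itv/= lexx yb0.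
have pyE (u : R) : u \in `[0, mdist a y] -> mdist (p u) y = `|u - mdist a y|.
  by move=> uI; rewrite -piso// pD.
have qyE (u : R) : u \in `[0, mdist y b] -> mdist y (q u) = `|0 - u|.
  by move=> uI; rewrite -qiso// q0.
pose g t := if t <= mdist a y then p t else q (t - mdist a y).
have gy : g (mdist a y) = y by rewrite /g lexx.
have g0 : g 0 = a by rewrite /g ay0.
have gD : g (mdist a y + mdist y b) = b.
  by rewrite /g gerDl leNgt yb/= addrC addKr.
have ab : g @` `[0, mdist a y + mdist y b] = segment a b.
  rewrite -[in RHS]g0 -[in X in segment _ X]gD; apply: lipschitz_arc; first lra.
    have lipW (s t : R) : s \in `[0, mdist a y + mdist y b] ->
        t \in `[0, mdist a y + mdist y b] -> s <= t ->
        mdist (g s) (g t) <= t - s.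
      rewrite !in_itv/= => /andP[s0 sD] /andP[t0 tD] st; rewrite /g.
      case: (leP s (mdist a y)) => [sy|ys]; case: (leP t (mdist a y)) => [ty|yt].
      - by rewrite piso ?in_itv/= ?s0 ?t0// distrC ger0_norm// subr_ge0.
      - have := metric_triangle (p s) y (q (t - mdist a y)).
        rewrite pyE ?qyE ?in_itv/=; try lra.
        rewrite sub0r normrN distrC ger0_norm ?subr_ge0//.
        by rewrite gtr0_norm ?subr_gt0//; lra.
      - lra.
      - by rewrite qiso ?in_itv/=; try lra; rewrite distrC ger0_norm; lra.
    move=> s t sD tD; case: (leP s t) => [st|/ltW ts].
      by rewrite (le_trans (lipW _ _ _ _ st))// distrC ler_norm.
    by rewrite metric_sym (le_trans (lipW _ _ _ _ ts))// ler_norm.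
  have injW (s t : R) : s \in `[0, mdist a y + mdist y b] ->
      t \in `[0, mdist a y + mdist y b] -> s <= t -> g s = g t -> s = t.
    rewrite !in_itv/= => /andP[s0 sD] /andP[t0 tD] st; rewrite /g.
    case: (leP s (mdist a y)) => [sy|ys]; case: (leP t (mdist a y)) => [ty|yt].
    - move=> pst; apply/eqP; rewrite -subr_eq0 -normr_eq0 -piso ?in_itv/= ?s0 ?t0//.
      by rewrite pst mdistxx.
    - move=> pq; exfalso.
      have : q (t - mdist a y) = y.
        apply: ayb.
          rewrite -pq -(geodesic_image pg); exists s => //=.
          by rewrite in_itv/= s0 sy.
        rewrite -(geodesic_image qg); exists (t - mdist a y) => //=.
        rewrite in_itv/=; lra.
      move=> /(congr1 (mdist y)); rewrite mdistxx qyE ?in_itv/=; try lra.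
      by move=> /eqP; rewrite normr_eq0 sub0r oppr_eq0 subr_eq0 gt_eqF.
    - lra.
    - move=> qst; have /eqP := mdistxx (q (s - mdist a y)); rewrite {2}qst.
      rewrite qiso ?in_itv/=; try lra.
      by rewrite normr_eq0 => /eqP; lra.
  move=> s t sD tD gst; case: (leP s t) => [st|/ltW ts]; first exact: injW.
  exact/esym/injW.
by rewrite -ab; exists (mdist a y) => //=; rewrite in_itv/=; lra.
Qed.

Lemma segment_split a b y z : segment a b y -> segment a b z ->
  segment a y z \/ segment y b z.
Proof.
have [p pg] := T_tree.1 a b; have [p0 pD piso] := pg.
rewrite -(geodesic_image pg) => -[s /= + <-] [t /= + <-].
have ab0 := mdist_ge0 a b.
have I0 : 0 \in `[0, mdist a b] by rewrite in_itv/= lexx.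
have ID : mdist a b \in `[0, mdist a b] by rewrite in_itv/= lexx ab0.
rewrite !segmentE/= => sI tI.
have aE u : u \in `[0, mdist a b] -> mdist a (p u) = `|0 - u|.
  by move=> uI; rewrite -piso// p0.
have bE u : u \in `[0, mdist a b] -> mdist (p u) b = `|u - mdist a b|.
  by move=> uI; rewrite -piso// pD.
rewrite !aE// !bE// !piso//.
move: sI tI; rewrite !in_itv/= => /andP[s0 sD] /andP[t0 tD].
have [ts|/ltW st] := leP t s; [left|right].
- rewrite !(distrC 0) !subr0 (ger0_norm s0) (ger0_norm t0) (distrC t).
  by rewrite ger0_norm ?subr_ge0//; lra.
- rewrite (distrC s t) (distrC s) (distrC t (mdist a b)).
  by rewrite !ger0_norm ?subr_ge0//; lra.
Qed.

End RealTreeSegments.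

(** * Contours and the insertion of an excursion *)
Section Contour.
Context {R : realType} {T : metricType R}.
Implicit Types (rho x y : T) (p g : R -> T) (s t r u l D : R).

(** By the first clause the height between the times [s] and [t] does not drop
    below that of the branch point of [p s] and [p t]; by the second this bound
    is attained. Together they say that the distance along [p] is the coding
    distance of the height, without mentioning an infimum. *)
Definition tree_coded rho p : Prop := forall s t, s <= t ->
  (forall r, s <= r <= t ->
     mdist rho (p s) + mdist rho (p t) <=
     mdist (p s) (p t) + 2 * mdist rho (p r)) /\
  exists2 r, s <= r <= t &
     mdist rho (p s) + mdist rho (p t) =
     mdist (p s) (p t) + 2 * mdist rho (p r).

(** Rest at the root outside [0, l] lets contours of different durations be
    seen as maps on the same line. *)
Definition contour rho l p : Prop :=
  [/\ forall t, t <= 0 -> p t = rho, forall t, l <= t -> p t = rho,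
      forall s t, mdist (p s) (p t) <= `|s - t| & tree_coded rho p].

(** The excursion inserted at time [s] has duration [2 * D]; [collapsed_time]
    is the time shown by a clock that stops during it. *)
Definition collapsed_time s D t : R :=
  if t <= s then t else if t <= s + 2 * D then s else t - 2 * D.

(** The distance to the starting point of an excursion that moves away from it
    at unit speed up to distance [D] and then returns. *)
Definition tent s D t : R :=
  if t <= s then 0 else if t <= s + D then t - s
  else if t <= s + 2 * D then s + 2 * D - t else 0.

Definition insert_excursion p g s D t : T :=
  if s < t <= s + 2 * D then g (tent s D t) else p (collapsed_time s D t).

(** The four phases, with the values of [collapsed_time] and [tent] in each.
    They overlap at their end points, where both descriptions agree. *)
Variant excursion_spec s D t : R -> R -> Prop :=
  | BeforeExcursion of t <= s : excursion_spec s D t t 0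
  | ExcursionUp of s <= t & t <= s + D : excursion_spec s D t s (t - s)
  | ExcursionDown of s + D <= t & t <= s + 2 * D :
      excursion_spec s D t s (s + 2 * D - t)
  | AfterExcursion of s + 2 * D <= t : excursion_spec s D t (t - 2 * D) 0.

Lemma excursionP s D t : 0 <= D ->
  excursion_spec s D t (collapsed_time s D t) (tent s D t).
Proof.
rewrite /collapsed_time /tent => D0; case: leP => [ts|/ltW st].
  exact: BeforeExcursion.
case: (leP t (s + D)) => [tD|/ltW Dt]; case: (leP t (s + 2 * D)) => [t2|/ltW t2].
- exact: ExcursionUp.
- have -> : t - s = 0 by lra.
  exact: AfterExcursion.
- exact: ExcursionDown.
- exact: AfterExcursion.
Qed.

Lemma tent_bounds s D t : 0 <= D -> 0 <= tent s D t <= D.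
Proof. by move=> D0; case: (excursionP s t D0) => *; lra. Qed.

Lemma collapsed_time_mono s D t u : 0 <= D -> t <= u ->
  collapsed_time s D t <= collapsed_time s D u.
Proof.
by move=> D0; case: (excursionP s t D0); case: (excursionP s u D0) => *; lra.
Qed.

Lemma tent_lipschitz s D t u : 0 <= D -> t <= u ->
  - (u - t) <= tent s D t - tent s D u <= u - t.
Proof.
by move=> D0; case: (excursionP s t D0); case: (excursionP s u D0) => *; lra.
Qed.

(** The Lipschitz bound between two times that are not both interior to the
    excursion: the path must then pass through its starting point, and the time
    spent in the excursion pays for the distances to it. *)
Lemma excursion_length s D t u : 0 <= D -> t <= u ->
    t <= s \/ s + 2 * D <= u ->
  collapsed_time s D u - collapsed_time s D t + tent s D t + tent s D u <= u - t.
Proof.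
move=> D0 tu tsu.
by case: (excursionP s t D0); case: (excursionP s u D0) => *; case: tsu; lra.
Qed.

(** Inside the excursion the height is lowest at the ends of a time interval,
    so the branch point of two positions is the lower one. *)
Lemma tent_concave s D t r u : 0 <= D -> s <= t -> t <= r -> r <= u ->
    u <= s + 2 * D ->
  tent s D t <= tent s D r \/ tent s D u <= tent s D r.
Proof.
move=> D0 st tr ru us; case: (leP r (s + D)) => [rD|/ltW Dr]; [left|right].
  by case: (excursionP s t D0); case: (excursionP s r D0) => *; lra.
by case: (excursionP s u D0); case: (excursionP s r D0) => *; lra.
Qed.

(** Carries a time at which the old height attains its bound to a time at which
    the new height does. When the old time is [s], the hypothesis on [t] and [u]
    leaves an end of the excursion between them, where the tent vanishes. *)
Lemma collapsed_time_lift s D t u r : 0 <= D -> t <= u ->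
    t <= s \/ s + 2 * D <= u ->
    collapsed_time s D t <= r <= collapsed_time s D u ->
  exists r', [/\ t <= r' <= u, collapsed_time s D r' = r & tent s D r' = 0].
Proof.
move=> D0 tu tsu /andP[tr ru].
have [rts|rts] := boolP ((r <= s) && (t <= s)).
  exists r; case/andP: rts => rs ts; split.
  - move: tr ru; rewrite {1}/collapsed_time ts.
    by case: (excursionP s u D0) => *; lra.
  - by rewrite /collapsed_time rs.
  - by rewrite /tent rs.
have sr : s <= r.
  move: rts tr; rewrite negb_and -!ltNge => /orP[|st]; first by move=> /ltW.
  by case: (excursionP s t D0) => *; lra.
exists (r + 2 * D); split.
- apply/andP; split; first by move: tr; case: (excursionP s t D0) => *; lra.
  have : s < r \/ s + 2 * D <= u.
    case: tsu => [ts|]; last by right.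
    by move: rts; rewrite ts andbT -ltNge; left.
  move=> sru; move: ru.
  by case: (excursionP s u D0) => *; case: sru; lra.
- by case: (excursionP s (r + 2 * D) D0) => *; lra.
- by case: (excursionP s (r + 2 * D) D0) => *; lra.
Qed.

(** The hypothesis on [g] says that [p s] is a gate between the old path and
    the new branch. Heights after the insertion are thus old heights at the
    collapsed time plus a [tent], and distances are old distances plus the two
    tents, except between two points of the new branch; what remains are the
    inequalities on [collapsed_time] and [tent] above. *)
Lemma contour_insert rho l p s D g : 0 <= s <= l -> 0 <= D ->
  contour rho l p -> g 0 = p s ->
  {in `[0, D] &, forall c e, mdist (g c) (g e) = `|c - e|} ->
  (forall u, {in `[0, D], forall c,
     mdist (p u) (g c) = mdist (p u) (p s) + c}) ->
  contour rho (l + 2 * D) (insert_excursion p g s D) /\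
  range (insert_excursion p g s D) = range p `|` g @` `[0, D].
Proof.
move=> /andP[s0 sl] D0 [pl0 pl plip pcode] g0 giso gate.
pose q := insert_excursion p g s D; rewrite -/q.
pose sg := collapsed_time s D; pose ta := tent s D.
have taI t : ta t \in `[0, D].
  by rewrite in_itv/=; exact: tent_bounds.
have prho : p 0 = rho by exact: pl0.
have qexc t : s <= t <= s + 2 * D -> q t = g (ta t).
  rewrite /q /insert_excursion /ta => /andP[st ->]; rewrite andbT.
  case: ltP => // ts; have -> : t = s by lra.
  by rewrite /tent /collapsed_time lexx g0.
have qold t : ~~ (s < t < s + 2 * D) -> q t = p (sg t) /\ ta t = 0.
  rewrite negb_and -!leNgt => tout.
  have ta0 : ta t = 0.
    by case/orP: tout => ?; rewrite /ta; case: (excursionP s t D0) => *; lra.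
  split=> //; rewrite /q /insert_excursion; case: ifP => // /andP[st tD].
  have tE : t = s + 2 * D by lra.
  rewrite -/(ta t) ta0 g0 /sg /collapsed_time lt_geF// tD//.
have sgexc t : s <= t <= s + 2 * D -> sg t = s.
  rewrite /sg /collapsed_time => /andP[st ->]; case: leP => //; lra.
have dpg u t : s <= t <= s + 2 * D ->
    mdist (p u) (q t) = mdist (p u) (p (sg t)) + ta t.
  by move=> tI; rewrite qexc// gate// sgexc.
have dpq u t : mdist (p u) (q t) = mdist (p u) (p (sg t)) + ta t.
  have [tI|tout] := boolP (s < t < s + 2 * D); last first.
    by have [-> ->] := qold _ tout; rewrite addr0.
  by apply: dpg; move: tI => /andP[/ltW-> /ltW->].
have hE t : mdist rho (q t) = mdist rho (p (sg t)) + ta t.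
  by rewrite -prho dpq.
have dE t u : ~~ (s < t < s + 2 * D) \/ ~~ (s < u < s + 2 * D) ->
    mdist (q t) (q u) = mdist (p (sg t)) (p (sg u)) + ta t + ta u.
  move=> [/qold[qE ->]|/qold[qE ->]]; rewrite qE ?addr0 ?dpq//.
  by rewrite metric_sym dpq metric_sym.
have dX t u : s <= t <= s + 2 * D -> s <= u <= s + 2 * D ->
    mdist (q t) (q u) = `|ta t - ta u|.
  by move=> tI uI; rewrite !qexc// giso.
have sgmono t u : t <= u -> sg t <= sg u.
  exact: collapsed_time_mono.
have caseP t u : t <= u -> (s <= t /\ u <= s + 2 * D) \/
    (~~ (s < t < s + 2 * D) /\ t <= s) \/
    (~~ (s < u < s + 2 * D) /\ s + 2 * D <= u).
  move=> tu; case: (leP t s) => ts.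
    by right; left; split=> //; rewrite negb_and -!leNgt ts.
  case: (leP u (s + 2 * D)) => us; first by left; split => //; exact: ltW.
  by right; right; split; rewrite ?negb_and -?leNgt ?(ltW us) ?orbT.
split; [split|].
- move=> t t0; have [] := qold t.
    by rewrite negb_and -!leNgt (le_trans t0 s0).
  move=> -> _.
  by rewrite /sg /collapsed_time (le_trans t0 s0) pl0.
- move=> t lt; have sDt : s + 2 * D <= t by lra.
  have [] := qold t; first by rewrite negb_and -!leNgt sDt orbT.
  move=> -> _.
  rewrite /sg /collapsed_time; case: leP => ts; first by rewrite pl//; lra.
  case: leP => tsD; last by rewrite pl//; lra.
  by rewrite pl//; lra.
- suff W t u : t <= u -> mdist (q t) (q u) <= u - t.
    move=> t u; case: (leP t u) => [tu|/ltW ut].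
      by rewrite (le_trans (W _ _ tu))// distrC ler_norm.
    by rewrite metric_sym (le_trans (W _ _ ut))// ler_norm.
  move=> tu; have := sgmono _ _ tu => sgtu.
  have := plip (sg t) (sg u); rewrite distrC ger0_norm ?subr_ge0// => plipE.
  case: (caseP _ _ tu) => [[st us]|].
    rewrite dX ?st ?us ?(le_trans st) ?(le_trans tu)// ler_norml.
    exact: tent_lipschitz.
  move=> C; rewrite dE; last by case: C => -[]; [left|right].
  have {}C : t <= s \/ s + 2 * D <= u by case: C => -[]; [left|right].
  by have := excursion_length D0 tu C; rewrite -/sg -/ta; lra.
- move=> t u tu; have := pcode _ _ (sgmono _ _ tu).
  move=> [plow [r0 /andP[tr0 r0u] r0E]].
  case: (caseP _ _ tu) => [[st us]|C].
    have tI : s <= t <= s + 2 * D by rewrite st (le_trans tu).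
    have uI : s <= u <= s + 2 * D by rewrite us (le_trans st).
    rewrite dX// !hE (sgexc _ tI) (sgexc _ uI); split.
      move=> r /andP[tr ru].
      have rI : s <= r <= s + 2 * D.
        by rewrite (le_trans st tr) (le_trans ru us).
      rewrite hE (sgexc _ rI).
      have := tent_concave D0 st tr ru us; rewrite -/ta.
      move=> rC; have : `|ta t - ta u| = ta t - ta u \/ `|ta t - ta u| = ta u - ta t.
        by case: ger0P => _; [left|right; rewrite opprB].
      by have := ler_norm (ta t - ta u); have := ler_norm (ta u - ta t);
        rewrite distrC; case: rC; lra.
    case: (leP (ta t) (ta u)) => tau.
      exists t; first by rewrite lexx.
      by rewrite hE (sgexc _ tI) distrC ger0_norm ?subr_ge0//; lra.
    exists u; first by rewrite lexx tu.
    by rewrite hE (sgexc _ uI) gtr0_norm ?subr_gt0//; lra.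
  rewrite dE; last by case: C => -[]; [left|right].
  have {}C : t <= s \/ s + 2 * D <= u by case: C => -[]; [left|right].
  rewrite !hE; split.
    move=> r /andP[tr ru]; rewrite hE.
    have := plow (sg r); rewrite !sgmono// => /(_ isT).
    by have := taI r; rewrite in_itv/= => /andP[? _]; lra.
  have [|r [tru rE ta0]] := collapsed_time_lift D0 tu C (r := r0).
    by rewrite tr0 r0u.
  rewrite -/(sg r) in rE; rewrite -/(ta r) in ta0.
  exists r => //; rewrite hE rE ta0; lra.
- rewrite eqEsubset; split.
    move=> _ [t _ <-]; rewrite /q /insert_excursion; case: ifP => _.
      by right; exists (ta t) => //=; exact: taI.
    by left; exists (sg t).
  move=> _ [[t _ <-]|[c /= cD <-]].
    have [ts|st] := leP t s.
      exists t => //; have [] := qold t; first by rewrite negb_and -!leNgt ts.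
      move=> -> _.
      by rewrite /sg /collapsed_time ts.
    exists (t + 2 * D) => //.
    have [] := qold (t + 2 * D); first by rewrite negb_and -!leNgt; lra.
    move=> -> _.
    congr p; rewrite /sg.
    by case: (excursionP s (t + 2 * D) D0) => *; lra.
  move: cD; rewrite in_itv/= => /andP[c0 cD].
  exists (s + c) => //; rewrite qexc; last by lra.
  congr g; rewrite /ta /tent lerD2l cD gerDl.
  by case: leP => [?|_]; [|rewrite addrC addKr]; lra.
Qed.

End Contour.

(** * Gates of convex subsets *)
Section SegmentConvexity.
Context {R : realType} {T : metricType R}.
Hypothesis T_tree : real_tree T.
Implicit Types (a b x y z : T) (S : set T).

Lemma segmentP x y z : segment x y z <-> mdist x z + mdist z y = mdist x y.
Proof. by rewrite (segmentE T_tree). Qed.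

Lemma segment_sym x y z : segment x y z -> segment y x z.
Proof.
move=> /segmentP xyz; apply/segmentP.
by rewrite !(metric_sym y) (metric_sym z x); lra.
Qed.

Lemma segmentxx x : segment x x = [set x].
Proof.
rewrite eqEsubset; split=> [z|_ ->]; last exact: segment_left.
move=> /segmentP; rewrite mdistxx (metric_sym z) => xz; apply: esym.
by apply: mdist_positivity; have := mdist_ge0 x z; lra.
Qed.

Lemma segment_subset_l a b x : segment a x b -> segment a b `<=` segment a x.
Proof.
move=> /segmentP axb z /segmentP abz; apply/segmentP.
have := metric_triangle z b x; have := metric_triangle a z x; lra.
Qed.

Lemma segment_subset a b x y :
  segment x y a -> segment x y b -> segment a b `<=` segment x y.
Proof.
move=> xya xyb; have [xab|ayb] := segment_split T_tree xya xyb.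
- move=> z /(segment_subset_l (segment_sym xab))/segment_sym.
  exact: segment_subset_l.
- move=> z /(segment_subset_l ayb)/segment_sym.
  by move=> /(segment_subset_l (segment_sym xya))/segment_sym.
Qed.

Definition segment_convex S : Prop :=
  forall a b, S a -> S b -> segment a b `<=` S.

Definition gate S x y : Prop := S y /\ forall w, S w -> segment w x y.

(** A closest point is a gate: the segment towards it meets [S] nowhere else,
    so it can be glued to the segments of [S]. *)
Lemma gate_exists S x : compact S -> S !=set0 -> segment_convex S ->
  exists y, gate S x y.
Proof.
move=> Scomp S0 Sconv.
have [y /set_mem Sy ymin] := compact_EVT_min S0 Scomp
  (continuous_subspaceT (@mdist_continuous _ _ x)).
exists y; split=> // w Sw; apply: (segment_glue T_tree) => z wyz /segmentP yxz.
have Sz : S z by exact: Sconv wyz.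
have := ymin z (mem_set Sz); rewrite (metric_sym x z) (metric_sym x y) => yz.
apply/esym/mdist_positivity.
by have := mdist_ge0 y z; lra.
Qed.

Lemma gate_segmentI S x y : gate S x y -> S `&` segment y x = [set y].
Proof.
move=> [Sy ygate]; rewrite eqEsubset; split=> [z [Sz yxz]|_ ->]; last first.
  by split=> //; exact: segment_left.
have /segmentP zxy := ygate _ Sz; move/segmentP : yxz => yxz.
apply/mdist_positivity; have := mdist_ge0 z y.
by rewrite (metric_sym y z) in yxz; lra.
Qed.

Lemma gate_dist S x y w z : gate S x y -> S w -> segment y x z ->
  mdist w z = mdist w y + mdist y z.
Proof.
move=> [Sy ygate] Sw /segmentP yxz.
have /segmentP wxy := ygate _ Sw.
have := metric_triangle w z x; have := metric_triangle w y z; lra.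
Qed.

(** A segment from [S] to a point of the new branch passes through the gate, so
    it splits into a segment of [S] and a part of the branch. *)
Lemma segment_convex_gate S x y : segment_convex S -> gate S x y ->
  segment_convex (S `|` segment y x).
Proof.
move=> Sconv ySx.
have mixed a b : S a -> segment y x b -> segment a b `<=` S `|` segment y x.
  move=> Sa yxb; have yab : segment a b y.
    by apply/segmentP; rewrite -(gate_dist ySx Sa yxb).
  move=> z /(segment_split T_tree yab)[ayz|ybz].
    by left; apply: Sconv ayz => //; exact: ySx.1.
  by right; exact: segment_subset_l yxb _ ybz.
move=> a b [Sa|yxa] [Sb|yxb].
- by move=> z abz; left; exact: Sconv abz.
- exact: mixed.
- by move=> z /segment_sym; exact: mixed.
- by move=> z abz; right; exact: segment_subset abz.
Qed.

End SegmentConvexity.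

(** * Contours of finitely generated subtrees *)
Section LengthOfContours.
Context {R : realType} {T : metricType R} {rho : T}.
Hypotheses (T_tree : real_tree T) (T_compact : compact [set: T]).
Variable ell : {measure set (skeleton_space rho) -> \bar R}.
Hypothesis ell_length : is_length_measure ell.
Local Notation trace A := (@skeleton_val _ _ rho @^-1` A).

Lemma measurable_trace_closed (A : set T) : closed A ->
  measurable (trace A).
Proof.
move=> Acl; exists A; last by rewrite setTI.
rewrite -(setCK A) -setTD; apply: sigma_algebraCD.
by apply: sub_gen_smallest; exact: closed_openC.
Qed.

Lemma closed_set1 (x : T) : closed [set x].
Proof.
apply: accessible_closed_set1; apply: hausdorff_accessible.
exact: metric_hausdorff.
Qed.

Lemma measurable_trace_open_segment (x y : T) :
  measurable (trace (open_segment x y)).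
Proof.
rewrite /open_segment setDE preimage_setI -preimage_setC preimage_setU.
apply: measurableI; first exact/measurable_trace_closed/closed_segment.
by apply/measurableC/measurableU; exact/measurable_trace_closed/closed_set1.
Qed.

(** The last clause bounds all durations by twice the length of the tree, and
    closedness and convexity of the range provide the next gate. *)
Definition exploration (l : R) (p : R -> T) : Prop :=
  [/\ contour rho l p, 0 <= l, closed (range p), segment_convex (range p) &
      ((l / 2)%:E <= ell (trace (range p)))%E].

Lemma exploration_extend l p x : exploration l p ->
  exists l' p', [/\ exploration l' p', range p `<=` range p' & range p' x].
Proof.
move=> [pcont l0 pcl pconv pell]; have [pl0 pl plip pcode] := pcont.
have prho : p 0 = rho by exact: pl0.
have pcomp := subclosed_compact pcl T_compact (@subsetT _ _).
have [|y [[s0 _ s0y] ygate]] := gate_exists T_tree x pcomp _ pconv.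
  by exists rho, 0.
(* A visit outside [0, l] is a visit to the root, which is also made at 0. *)
have [s /andP[sge0 sl] sy] : exists2 s, 0 <= s <= l & p s = y.
  have [s0lt|s0ge] := ltP s0 0.
    by exists 0; rewrite ?lexx// -s0y !pl0// ltW.
  have [s0l|ls0] := leP s0 l; first by exists s0; rewrite ?s0ge.
  by exists 0; rewrite ?lexx// -s0y pl0// pl// ltW.
have [g gg] := T_tree.1 y x; have [g0 gD giso] := gg.
have yS : gate (range p) x y by split=> //; exists s.
pose D := mdist y x; have D0 : 0 <= D by exact: mdist_ge0.
have [||u c cD|qcont] := contour_insert _ D0 pcont _ giso (s := s).
- by rewrite sge0.
- by rewrite g0 sy.
- have gc : segment y x (g c).
    by rewrite -(geodesic_image T_tree gg); exists c.
  rewrite (gate_dist T_tree yS (imageP p I) gc).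
  congr (_ + _); first by rewrite sy.
  rewrite -[in LHS]g0 giso// ?in_itv/= ?lexx ?D0//.
  by move: cD; rewrite in_itv/= sub0r normrN => /andP[c0 _]; rewrite ger0_norm.
rewrite (geodesic_image T_tree gg).
set q := insert_excursion p g s D => qrange.
exists (l + 2 * D), q; rewrite qrange; split; first split => //.
- lra.
- by rewrite qrange; apply: closedU => //; exact: closed_segment.
- by rewrite qrange; exact: (segment_convex_gate T_tree).
- rewrite qrange.
  apply: (@le_trans _ _ (ell (trace (range p `|` open_segment y x)))); last first.
    apply: le_measure; rewrite ?inE/=.
    + rewrite preimage_setU; apply: measurableU.
        exact: measurable_trace_closed.
      exact: measurable_trace_open_segment.
    + by apply: measurable_trace_closed; apply: closedU => //; exact: closed_segment.
    + by move=> z [pz|[yxz _]]; [left|right].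
  have -> : ell (trace (range p `|` open_segment y x)) =
      (ell (trace (range p)) + D%:E)%E.
    rewrite -ell_length.1; apply: measureU.
    - exact: measurable_trace_closed.
    - exact: measurable_trace_open_segment.
    - rewrite -preimage_setI (_ : _ `&` _ = set0) ?preimage_set0//.
      rewrite -subset0 => z [pz [yxz]]; apply; left.
      have : (range p `&` segment y x) z by [].
      by rewrite (gate_segmentI T_tree yS).
  rewrite (_ : (l + 2 * D) / 2 = l / 2 + D); last by field.
  by rewrite EFinD leeD2r.
- by move=> z; left.
- by right; exact: segment_right.
Qed.

Lemma exploration_seq (xs : seq T) :
  exists l p, exploration l p /\ {in xs, forall x, range p x}.
Proof.
elim: xs => [|x xs [l [p [pexp pxs]]]].
  have rangeE : range (fun _ : R => rho) = [set rho].
    by rewrite eqEsubset; split=> [_ [_ _ <-]//|_ ->]; exists 0.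
  exists 0, (fun=> rho); split=> //; split=> //.
  - split=> // s t; first by rewrite mdistxx.
    move=> st; split=> [r _|]; first by rewrite mdistxx; lra.
    by exists s; rewrite ?lexx// mdistxx; lra.
  - by rewrite rangeE; exact: closed_set1.
  - by rewrite rangeE => _ _ -> ->; rewrite (segmentxx T_tree).
  - by rewrite mul0r measure_ge0.
have [l' [p' [p'exp pp' p'x]]] := exploration_extend x pexp.
exists l', p'; split=> // z; rewrite in_cons => /orP[/eqP->//|zxs].
exact/pp'/pxs.
Qed.

End LengthOfContours.

(** * Limits of contours *)

(** Of a set and its complement one has its preimage in [U], which decides
    membership in every larger proper filter. *)
Lemma fmap_ultra (X Y : Type) (f : X -> Y) (U : set_system X) :
  UltraFilter U -> UltraFilter (f @ U).
Proof.
move=> UU; split; first exact: fmap_proper_filter.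
move=> G GF UG; rewrite eqEsubset; split=> // A GA.
have [//|UnA] := in_ultra_setVsetC (f @^-1` A) UU.
by have /filter_ex[y []] : G (A `&` ~` A) by apply: filterI => //; exact: UG.
Qed.

Section ContourLimit.
Context {R : realType} {T : metricType R}.
Hypothesis T_compact : compact [set: T].
Variables (rho : T) (M : R).

(** An ultrafilter on maps turns compactness of the target into pointwise
    convergence, without extracting subsequences. *)
Lemma ultra_pointwise_limit (U : set_system (R -> T)) : UltraFilter U ->
  exists P : R -> T,
    forall t e, 0 < e -> U [set p | mdist (P t) (p t) < e].
Proof.
move=> UU.
suff /choice[P UP] : forall t, exists x : T,
    forall e, 0 < e -> U [set p : R -> T | mdist x (p t) < e] by exists P.
move=> t; have Ut := @fmap_ultra _ _ (fun p : R -> T => p t) U UU.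
have := T_compact; rewrite compact_ultra => /(_ ((fun p : R -> T => p t) @ U)).
case=> [|x [_ cvgx]]; first exact: filterT.
exists x => e e0.
exact: (metricType_numDomainType.cvgr_dist_lt (F := U) cvgx).
Qed.

(** Times chosen along the paths converge too, and the equi-Lipschitz bound lets
    the path and the time pass to the limit simultaneously. This is how the
    existential properties, attained bounds and visited points, survive. *)
Lemma ultra_time_limit (U : set_system (R -> T)) (P : R -> T)
    (r : (R -> T) -> R) (a b : R) : UltraFilter U ->
  (forall t e, 0 < e -> U [set p | mdist (P t) (p t) < e]) ->
  U [set p | forall s t, mdist (p s) (p t) <= `|s - t|] ->
  U [set p | a <= r p <= b] ->
  exists2 r0, a <= r0 <= b &
    forall e, 0 < e -> U [set p | mdist (P r0) (p (r p)) < e].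
Proof.
move=> UU UP Ulip Ur.
have Ur' := @fmap_ultra _ _ r U UU; have := @segment_compact R a b.
rewrite compact_ultra => /(_ (r @ U)).
case=> [|r0 [r0ab cvgr0]].
  suff : U (r @^-1` `[a, b]) by [].
  by apply: filterS Ur => p pab; rewrite /= in_itv.
exists r0; first by move: r0ab; rewrite /= in_itv.
move=> e e0; have e20 : 0 < e / 2 by rewrite divr_gt0.
have Ur0 : U [set p | `|r0 - r p| < e / 2].
  exact: (@cvgr_dist_lt R R _ U _ r r0 cvgr0 _ e20).
apply: filterS (filterI (filterI (UP r0 _ e20) Ur0) Ulip) => p [[/= Pp r0p] plip].
by have := metric_triangle (P r0) (p r0) (p (r p)); have := plip r0 (r p); lra.
Qed.

(** The ultrafilter contains, for each finite set of points, the contours that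
    visit all of them; each property of the limit needs only finitely many
    times and one point, so it is read off from a single nearby contour. *)
Lemma contour_limit : 0 <= M ->
  (forall xs : seq T,
     exists p, contour rho M p /\ {in xs, forall x, range p x}) ->
  exists P, contour rho M P /\ range P = [set: T].
Proof.
move=> M0 approx.
pose B (xs : seq T) := [set p | contour rho M p /\ {in xs, forall x, range p x}].
have FF : ProperFilter (filter_from setT B).
  apply: filter_from_proper => [|xs _]; last first.
    by have [p] := approx xs; exists p.
  apply: filter_from_filter; first by exists [::].
  move=> xs ys _ _; exists (xs ++ ys) => // p [pc pxy].
  by split; split=> // x xI; apply: pxy; rewrite mem_cat xI ?orbT.
have [U [UU FU]] := ultraFilterLemma FF.
have UB xs : U (B xs) by apply: FU; exists xs.
have [P UP] := ultra_pointwise_limit UU.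
have Uc : U [set p | contour rho M p] by apply: filterS (UB [::]) => p [].
have Ulip : U [set p | forall s t, mdist (p s) (p t) <= `|s - t|].
  by apply: filterS Uc => p [].
have eq_of_lt (x y : T) : (forall e : R, 0 < e -> mdist x y < e) -> x = y.
  move=> xy; apply: mdist_positivity; apply/eqP; rewrite eq_le mdist_ge0 andbT.
  by apply/ler_addgt0Pr => e e0; rewrite add0r ltW// xy.
have hdiff (x y : T) : mdist rho x <= mdist rho y + mdist x y.
  by rewrite (metric_sym x); exact: metric_triangle.
have UI C D : U C -> U D -> U (C `&` D) by exact: filterI.
exists P; split; [split|].
- move=> t t0; apply: eq_of_lt => e e0.
  by have /filter_ex[p [/= + [pt0 _ _ _]]] := UI _ _ (UP t e e0) Uc; rewrite pt0.
- move=> t tM; apply: eq_of_lt => e e0.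
  by have /filter_ex[p [/= + [_ ptM _ _]]] := UI _ _ (UP t e e0) Uc; rewrite ptM.
- move=> s t; apply/ler_addgt0Pr => e e0.
  have e20 : 0 < e / 2 by rewrite divr_gt0.
  have /filter_ex[p [[/= ps pt] plip]] :=
    UI _ _ (UI _ _ (UP s _ e20) (UP t _ e20)) Ulip.
  have := metric_triangle (P s) (p s) (P t).
  have := metric_triangle (p s) (p t) (P t).
  by have := plip s t; rewrite (metric_sym (p t) (P t)); lra.
- move=> s t st; split.
    move=> r /andP[sr rt]; apply/ler_addgt0Pr => e e0.
    have e60 : 0 < e / 6 by rewrite divr_gt0.
    have /filter_ex[p [[[/= ps pt] pr] [_ _ _ pcode]]] :=
      UI _ _ (UI _ _ (UI _ _ (UP s _ e60) (UP t _ e60)) (UP r _ e60)) Uc.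
    have [/(_ r) + _] := pcode s t st; rewrite sr rt => /(_ isT).
    have := hdiff (P s) (p s); have := hdiff (P t) (p t).
    have := hdiff (p r) (P r); rewrite (metric_sym (p r) (P r)).
    have := metric_triangle (p s) (P s) (p t).
    have := metric_triangle (P s) (P t) (p t); rewrite (metric_sym (p s) (P s)); lra.
  have /choice[r rP] : forall p : R -> T, exists r, contour rho M p ->
      s <= r <= t /\ mdist rho (p s) + mdist rho (p t) =
        mdist (p s) (p t) + 2 * mdist rho (p r).
    move=> p; have [pc|pnc] := pselect (contour rho M p); last by exists 0.
    by have [_ _ _ /(_ s t st)[_ [r rst rE]]] := pc; exists r.
  have [|r0 r0st Ur0] := @ultra_time_limit U P r s t UU UP Ulip.
    by apply: filterS Uc => p /rP[].
  exists r0 => //; apply/eqP; rewrite -subr_eq0 -normr_eq0 eq_le normr_ge0 andbT.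
  apply/ler_addgt0Pr => e e0; rewrite add0r.
  have e60 : 0 < e / 6 by rewrite divr_gt0.
  have /filter_ex[p [[[/= ps pt] pr] /rP[_ rE]]] :=
    UI _ _ (UI _ _ (UI _ _ (UP s _ e60) (UP t _ e60)) (Ur0 _ e60)) Uc.
  have h1 := hdiff (P s) (p s); have h2 := hdiff (p s) (P s).
  have h3 := hdiff (P t) (p t); have h4 := hdiff (p t) (P t).
  have h5 := hdiff (P r0) (p (r p)); have h6 := hdiff (p (r p)) (P r0).
  have h7 := metric_triangle (p s) (P s) (p t).
  have h8 := metric_triangle (P s) (P t) (p t).
  have h9 := metric_triangle (P s) (p s) (P t).
  have h10 := metric_triangle (p s) (p t) (P t).
  rewrite (metric_sym (p s) (P s)) in h2 h7.
  rewrite (metric_sym (p t) (P t)) in h4 h10.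
  rewrite (metric_sym (p (r p))) in h6.
  by rewrite ler_norml; apply/andP; split; lra.
- rewrite -subTset => x _.
  have /choice[r rP] : forall p : R -> T, exists r, B [:: x] p ->
      0 <= r <= M /\ p r = x.
    move=> p; have [[pc px]|pnc] := pselect (B [:: x] p); last by exists 0.
    have [t _ ptx] := px x (mem_head _ _); have [p0 pM _ _] := pc.
    have [t0|t0] := ltP t 0.
      by exists 0; rewrite lexx M0 -ptx !p0// ltW.
    have [tM|tM] := leP t M; first by exists t; rewrite t0 tM.
    exists 0; rewrite lexx M0 -ptx; split=> //.
    by rewrite (p0 0)// (pM t)// ltW.
  have [|r0 _ Ur0] := @ultra_time_limit U P r 0 M UU UP Ulip.
    by apply: filterS (UB [:: x]) => p /rP[].
  exists r0 => //; apply: eq_of_lt => e e0.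
  by have /filter_ex[p [/= Pr /rP[_ <-]]] := UI _ _ (Ur0 e e0) (UB [:: x]).
Qed.

End ContourLimit.

(** * Coded trees and the height of a contour *)
Section CodedTree.
Context {R : realType} {T : metricType R}.

(** Representatives of the classes turn an isometry into a parametrization, and
    conversely; this keeps the quotient out of the other proofs. *)
Lemma isometric_coded_treeP (h : heightFun R) :
  isometric T (coded_tree h) <->
  exists p : R -> T,
    (forall x, exists2 t, t \in `[0, hf_bound h] & p t = x) /\
    {in `[0, hf_bound h] &,
      forall s t, mdist (p s) (p t) = coding_dist h s t}.
Proof.
pose cl (u : coding_dom h) : coded_tree h := (\pi_(coded_tree h) u)%qT.
have clE (u v : coding_dom h) :
    mdist (cl u) (cl v) = coding_dist h (val u) (val v).
  exact: coded_dist_pi.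
have cl_repr c : cl (repr c) = c by exact: reprK.
split=> [[f [g fK gK] fiso]|[p [psurj pdist]]].
  have /choice[p pE] : forall t : R, exists x : T,
      forall u : coding_dom h, val u = t -> x = g (cl u).
    move=> t; have [[u ut]|nu] := pselect (exists u : coding_dom h, val u = t).
      exists (g (cl u)) => v vt.
      by congr (g (cl _)); apply: val_inj; rewrite /= ut vt.
    have h0 : 0 \in `[0, hf_bound h] by rewrite in_itv/= lexx hf_bound_ge0.
    exists (g (cl (exist _ 0 h0))).
    by move=> u ut; exfalso; apply: nu; exists u.
  exists p; split=> [x|s t sM tM].
    exists (val (repr (f x))); first exact: (valP (repr (f x))).
    by rewrite (pE _ _ erefl) cl_repr.
  rewrite (pE s (exist _ s sM))// (pE t (exist _ t tM))//.
  by rewrite -fiso !gK clE.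
have /choice[t tP] : forall x, exists t, t \in `[0, hf_bound h] /\ p t = x.
  by move=> x; have [t tM <-] := psurj x; exists t.
pose f x : coded_tree h := cl (exist _ (t x) (tP x).1).
pose g (c : coded_tree h) : T := p (val (repr c)).
have fgE x c : mdist (f x) c = mdist x (g c).
  rewrite -{1}(cl_repr c) clE -pdist/=; [|exact: (tP x).1|exact: (valP (repr c))].
  by rewrite (tP x).2.
exists f.
  exists g => [x|c].
    by apply/esym/mdist_positivity; rewrite -fgE mdistxx.
  by apply: mdist_positivity; rewrite fgE mdistxx.
move=> x y; rewrite clE/= -pdist; [|exact: (tP x).1|exact: (tP y).1].
by rewrite (tP x).2 (tP y).2.
Qed.

Lemma coding_distC (h : R -> R) s t : coding_dist h s t = coding_dist h t s.
Proof. by rewrite /coding_dist minC maxC (addrC (h s)). Qed.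

Lemma tree_coded_dist (rho : T) (p : R -> T) s t : tree_coded rho p ->
  coding_dist (mdist rho \o p) s t = mdist (p s) (p t).
Proof.
move=> pcode; wlog st : s t / s <= t.
  move=> W; have [st|/ltW ts] := leP s t; first exact: W.
  by rewrite coding_distC metric_sym W.
rewrite /coding_dist min_l// max_r//=.
have [plow [r rst rE]] := pcode s t st.
have -> : inf ((mdist rho \o p) @` `[s, t]) = mdist rho (p r).
  apply/eqP; rewrite eq_le; apply/andP; split.
    apply: ge_inf; last by exists r => //=; rewrite in_itv.
    by exists 0 => _ [? _ <-]; exact: mdist_ge0.
  apply: lb_le_inf; first by exists (mdist rho (p r)), r => //=; rewrite in_itv.
  move=> _ [u /= + <-]; rewrite in_itv/= => ust.
  by have := plow u ust; lra.
by move: rE; rewrite /=; lra.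
Qed.

Section HeightOfContour.
Variables (rho : T) (M : R) (p : R -> T).
Hypotheses (M0 : 0 <= M) (pcont : contour rho M p).

Let h (t : R) := mdist rho (p t).

Let h_continuous : continuous h.
Proof.
have [_ _ plip _] := pcont.
move=> t; apply: continuous_comp; last exact: mdist_continuous.
have : {within [set: R], continuous p}.
  by apply: (@lipschitz_within_continuous _ _ 1) => u v _ _; rewrite mul1r.
by move=> pc; exact: ((continuous_subspace_setT p).2 pc t).
Qed.

Let h_right t : h r @[r --> t^'+] --> h t.
Proof. exact/cvg_at_right_filter/h_continuous. Qed.

Let h_ge0 t : t \in `[0, M] -> 0 <= h t.
Proof. by move=> _; exact: mdist_ge0. Qed.

Let h_left t : t \in `]0, M] -> h r @[r --> t^'-] --> h t.
Proof. by move=> _; exact/cvg_at_left_filter/h_continuous. Qed.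

Let h_right_limit t : t \in `[0, M[ -> cvg (h r @[r --> t^'+]).
Proof. by move=> _; apply/cvg_ex; exists (h t). Qed.

Let h0 : h 0 = 0.
Proof. by have [p0 _ _ _] := pcont; rewrite /h p0// mdistxx. Qed.

Let h0_right : 0 < M -> h r @[r --> 0^'+] --> (0 : R).
Proof. by move=> _; rewrite -[X in _ --> X]h0; exact: h_right. Qed.

Let h_jump t : t \in `[0, M[ -> 0 <= h t - lim (h r @[r --> t^'+]).
Proof. move=> _; have -> : lim (h r @[r --> t^'+]) = h t; last by rewrite subrr.
by apply: cvg_lim => //; exact: h_right. Qed.

Definition contour_height : heightFun R :=
  HeightFun M0 h_ge0 h_left h_right_limit h0 h0_right h_jump.

(** A 1-Lipschitz function becomes nondecreasing once the identity is added. *)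
Lemma contour_height_BV : bounded_variation 0 M contour_height.
Proof.
have [_ _ plip _] := pcont.
have hlip s t : s <= t -> `|h s - h t| <= t - s.
  move=> st; have := plip s t; rewrite distrC.
  rewrite (ger0_norm (_ : 0 <= t - s)) ?subr_ge0//.
  have := metric_triangle rho (p s) (p t).
  have := metric_triangle rho (p t) (p s).
  by rewrite (metric_sym (p t)) ler_norml /h; lra.
have [->|M_gt0] : M = 0 \/ 0 < M.
    by move: M0; rewrite le_eqVlt => /predU1P[->|]; [left|right].
  exact: bounded_variationxx.
have -> : (contour_height : R -> R) = (fun t => h t + t) \+ (\- id).
  by apply/funext => t /=; rewrite addrK.
apply: bounded_variationD => //; last first.
  by apply/bounded_variationN/nondecreasing_bounded_variation.
apply: nondecreasing_bounded_variation => // s t _ _ st.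
by have := hlip s t st; rewrite ler_norml => /andP[]; lra.
Qed.

End HeightOfContour.

Lemma contour_height_isometric (rho : T) (M : R) (p : R -> T) (M0 : 0 <= M)
    (pcont : contour rho M p) : range p = [set: T] ->
  isometric T (coded_tree (contour_height M0 pcont)).
Proof.
move=> psurj; apply/isometric_coded_treeP; have [p0 pM plip pcode] := pcont.
exists p; split=> [x|s t _ _ /=]; last by rewrite -(tree_coded_dist s t pcode).
have [t _ ptx] : range p x by rewrite psurj.
have [t0|t0] := ltP t 0.
  by exists 0; rewrite ?in_itv/= ?lexx ?M0// -ptx !p0// ltW.
have [tM|tM] := leP t M; first by exists t; rewrite // in_itv/= t0 tM.
by exists M; rewrite ?in_itv/= ?lexx ?M0// -ptx !pM// ltW.
Qed.

End CodedTree.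

(** Every exploration lasts at most twice the total length, which is therefore a
    common duration for all the contours. *)
Lemma finite_length_coded (R : realType) (T : metricType R)
    (T_tree : real_tree T) (T_compact : compact [set: T]) (rho : T)
    (ell : {measure set (skeleton_space rho) -> \bar R})
    (ell_length : is_length_measure ell) :
  (ell [set: skeleton_space rho] < +oo)%E ->
  exists h : heightFun R,
    bounded_variation 0 (hf_bound h) h /\ isometric T (coded_tree h).
Proof.
move=> ell_fin; pose L := fine (ell setT).
have LE : ell setT = L%:E by rewrite fineK// ge0_fin_numE.
have L0 : 0 <= 2 * L by rewrite mulr_ge0// fine_ge0.
have [xs|P [Pcont Psurj]] := contour_limit T_compact (rho := rho) L0.
  have [l [p [[pcont l0 pcl _ pell] pxs]]] :=
    exploration_seq T_tree T_compact ell_length xs.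
  exists p; split=> //; have [p0 pl plip pcode] := pcont; split=> // t Lt.
  apply: pl; apply: le_trans Lt.
  have : ((l / 2)%:E <= L%:E)%E.
    rewrite -LE; apply: le_trans pell _; apply: le_measure; rewrite ?inE//.
    exact: measurable_trace_closed.
  by rewrite lee_fin; lra.
by exists (contour_height L0 Pcont); split;
  [exact: contour_height_BV|exact: contour_height_isometric].
Qed.

(** * Cuts of the tree and the length of its segments *)

(** The points that belong to every [F n] from rank [N] on form a set that
    increases with [N], and continuity from below applies to these sets. *)
Lemma measure_eventually_le d (X : measurableType d) (R : realType)
    (mu : {measure set X -> \bar R}) (F : (set X)^nat) (A : set X)
    (V : \bar R) :
  (forall n, measurable (F n)) -> measurable A ->
  (forall n, (mu (F n) <= V)%E) ->
  (forall x, A x -> \forall n \near \oo, F n x) -> (mu A <= V)%E.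
Proof.
move=> mF mA muF AF; pose G N := \bigcap_(n in [set n | (N <= n)%N]) F n.
have mG N : measurable (G N) by apply: bigcap_measurable; first by exists N => /=.
have mGU : measurable (\bigcup_N G N) by exact: bigcupT_measurable.
have AG : A `<=` \bigcup_N G N.
  by move=> x /AF[N _ Nx]; exists N => // n; exact: Nx.
apply: (@le_trans _ _ (mu (\bigcup_N G N))).
  by apply: le_measure; rewrite ?inE.
have Gincr : {homo G : n m / (n <= m)%N >-> (n <= m)%O}.
  move=> n m nm; rewrite subsetEset => x Gx k /= mk; apply: Gx => /=.
  exact: leq_trans mk.
have cvgG := nondecreasing_cvg_mu (mu := mu) mG mGU Gincr.
rewrite -(cvg_lim _ cvgG)//; apply: lime_le.
  by apply/cvg_ex; exists (mu (\bigcup_N G N)).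
apply: nearW => n /=; apply: le_trans (muF n).
apply: le_measure; rewrite ?inE// => x; apply => /=.
exact: leqnn.
Qed.

Section LengthUpperBound.
Context {R : realType} {T : metricType R} {rho : T}.
Hypothesis T_tree : real_tree T.
Implicit Types (a b x y z : T).

(** The form in which disconnectedness of the complement of [x] is used: two
    sides, and [x] between any two points of different sides. *)
Definition cut_by x (A B : set T) : Prop :=
  [/\ open A, open B, A `|` B = ~` [set x] &
      forall a b, A a -> B b -> segment a b x].

Lemma cut_by_sym x (A B : set T) : cut_by x A B -> cut_by x B A.
Proof.
move=> [Ao Bo AB ABx]; split=> //; first by rewrite setUC.
by move=> b a Bb Aa; apply: (segment_sym T_tree); exact: ABx.
Qed.

Lemma skeleton_cut x : skeleton rho x -> x <> rho ->
  exists A B, [/\ cut_by x A B, A !=set0 & B !=set0].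
Proof.
move=> skx xrho; have /connectedPn[E [E0 EU sE]] : ~ connected (~` [set x]).
  by move=> cx; apply: skx.
have EI : E false `&` E true = set0 by exact: separated_disjoint.
have [sE1 sE2] := sE.
have Eopen (b : bool) : open (E b).
  have -> : E b = ~` [set x] `&` ~` closure (E (~~ b)).
    rewrite EU eqEsubset; split=> z.
      move=> Ez; split; first by case: b Ez; [right|left].
      move=> cz; case: b Ez cz => /= Ez cz.
      - by have : (closure (E false) `&` E true) z by []; rewrite sE1.
      - by have : (E false `&` closure (E true)) z by []; rewrite sE2.
    move=> [Ez ncz]; case: b ncz => /= ncz; case: Ez => // /subset_closure //.
  apply: openI; first exact/closed_openC/closed_set1.
  exact/closed_openC/closed_closure.
exists (E false), (E true); split; [split=> //|exact: E0|exact: E0].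
move=> a b Ea Eb; apply: contrapT => nx.
have subE : segment a b `<=` E false `|` E true.
  by rewrite -EU => z abz zx; apply: nx; rewrite -zx.
have abC := connected_segment T_tree (x := a) (y := b).
have [sub|sub] := connected_subset sE subE abC.
- have : (E false `&` E true) b by split=> //; exact/sub/segment_right.
  by rewrite EI.
- have : (E false `&` E true) a by split=> //; exact/sub/segment_left.
  by rewrite EI.
Qed.

Lemma cut_by_disjoint x (A B : set T) : cut_by x A B -> A `&` B = set0.
Proof.
move=> [_ _ AB ABx]; rewrite -subset0 => z [Az Bz].
have : (A `|` B) z by left.
by rewrite AB; apply; have := ABx z z Az Bz; rewrite (segmentxx T_tree) => ->.
Qed.

(** As long as no link contains [x], the chain stays on the side where it is:
    otherwise [x] would lie between two consecutive points. *)
Lemma cut_by_chain x (A B : set T) (q : nat -> T) (n : nat) : cut_by x A B ->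
  (exists2 i, (i <= n)%N & A (q i)) -> (exists2 j, (j <= n)%N & B (q j)) ->
  exists2 k, (k < n)%N & segment (q k) (q k.+1) x.
Proof.
have stay (C D : set T) i j : cut_by x C D ->
    (forall k, (k < n)%N -> ~ segment (q k) (q k.+1) x) ->
    (i <= j <= n)%N -> C (q i) -> C (q j).
  move=> [_ _ CD CDx] noseg; elim: j => [|j IH] /andP[ij jn] Ci.
    by move: ij; rewrite leqn0 => /eqP <-.
  move: ij; rewrite leq_eqVlt => /predU1P[<-//|ij].
  have Cj : C (q j) by apply: IH => //; rewrite -ltnS ij ltnW.
  have : (C `|` D) (q j.+1).
    by rewrite CD => qx; apply: (noseg j jn); rewrite -qx; exact: segment_right.
  by move=> [//|Dj]; exfalso; exact: (noseg j jn (CDx _ _ Cj Dj)).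
move=> AB [i iN Ai] [j jn Bj]; apply: contrapT => nok.
have noseg k : (k < n)%N -> ~ segment (q k) (q k.+1) x.
  by move=> kn kx; apply: nok; exists k.
have [ij|/ltnW ji] := leqP i j.
  have Aj : A (q j) by apply: (stay A B i j) => //; rewrite ij.
  by have : (A `&` B) (q j) by []; rewrite (cut_by_disjoint AB).
have Bi : B (q i).
  by apply: (stay B A j i) => //; [exact: cut_by_sym|rewrite ji].
by have : (A `&` B) (q i) by []; rewrite (cut_by_disjoint AB).
Qed.

Variable ell : {measure set (skeleton_space rho) -> \bar R}.
Hypothesis ell_length : is_length_measure ell.
Local Notation trace A := (@skeleton_val _ _ rho @^-1` A).

(** A point of the skeleton other than the root lies inside some segment, which
    it divides into two open segments whose lengths already add up to the whole
    length, so that nothing is left for the point. *)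
Lemma length_set1 x : ell (trace [set x]) = 0%E.
Proof.
have [->|xrho] := pselect (x = rho); first exact: ell_length.2.
have [skx|nskx] := pselect (skeleton rho x); last first.
  rewrite (_ : trace _ = set0) ?measure0// -subset0 => -[z zsk] /= zx.
  by apply: nskx; rewrite -zx; exact: set_mem.
have [A [B [[_ _ AB ABx] [a Aa] [b Bb]]]] := skeleton_cut skx xrho.
have xa : x <> a by move=> xa; have : (A `|` B) a by [left]; rewrite AB; apply.
have xb : x <> b by move=> xb; have : (A `|` B) b by [right]; rewrite AB; apply.
have abx := ABx a b Aa Bb; have /(segmentP T_tree) abxE := abx.
have mo y z : measurable (trace (open_segment y z)).
  exact: measurable_trace_open_segment.
have m1 : measurable (trace [set x]) by exact/measurable_trace_closed/closed_set1.
have e1 : ell (trace (open_segment a x) `|` trace [set x]) =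
    ((mdist a x)%:E + ell (trace [set x]))%E.
  rewrite -ell_length.1; apply: measureU => //.
  rewrite -preimage_setI (_ : _ `&` _ = set0) ?preimage_set0// -subset0.
  by move=> z [[_ nz] zx]; apply: nz; right.
have e2 : ell ((trace (open_segment a x) `|` trace [set x]) `|`
      trace (open_segment x b)) =
    ((mdist a x)%:E + ell (trace [set x]) + (mdist x b)%:E)%E.
  rewrite -e1 -(ell_length.1 x b); apply: measureU => //; first exact: measurableU.
  rewrite -preimage_setU -preimage_setI (_ : _ `&` _ = set0) ?preimage_set0//.
  rewrite -subset0 => z [[[/(segmentP T_tree) axz nz]|zx] [/(segmentP T_tree) xbz nz']].
    apply: nz; right; apply: mdist_positivity.
    have := metric_triangle a z b; rewrite (metric_sym x z) in xbz.
    by have := mdist_ge0 z x; lra.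
  by apply: nz'; left.
have : (ell ((trace (open_segment a x) `|` trace [set x]) `|`
      trace (open_segment x b)) <= ell (trace (open_segment a b)))%E.
  apply: le_measure; rewrite ?inE//; first by do 2 apply: measurableU => //.
  move=> [z zsk]; rewrite /= => -[[[axz nz]|->]|[xbz nz]].
  - split; first exact: (segment_subset T_tree) (segment_left T_tree a b) abx _ axz.
    move=> [za|zb]; first by apply: nz; left.
    apply: xb; apply: mdist_positivity; move/(segmentP T_tree): axz.
    rewrite zb (metric_sym b x); have := mdist_ge0 x b; lra.
  - by split=> // -[].
  - split; first exact: (segment_subset T_tree) abx (segment_right T_tree a b) _ xbz.
    move=> [za|zb]; last by apply: nz; right.
    apply: xa; apply: mdist_positivity; move/(segmentP T_tree): xbz.
    rewrite za (metric_sym x a); have := mdist_ge0 a x; lra.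
have : (0 <= ell (trace [set x]))%E by exact: measure_ge0.
rewrite e2 ell_length.1 -abxE; case: (ell _) => [r| |] //=.
by rewrite -!EFinD !lee_fin => r0 rle; congr EFin; lra.
Qed.

Lemma length_segment_le x y : (ell (trace (segment x y)) <= (mdist x y)%:E)%E.
Proof.
have -> : segment x y = open_segment x y `|` ([set x] `|` [set y]).
  rewrite eqEsubset; split=> z; last first.
    by move=> [[]//|[->|->]]; [exact: segment_left|exact: segment_right].
  by have [zxy|nz] := pselect (([set x] `|` [set y]) z); [right|left; split].
have m1 z : measurable (trace [set z]) by exact/measurable_trace_closed/closed_set1.
have e2 : (ell (trace ([set x] `|` [set y])) <= 0)%E.
  have <- : (ell (trace [set x]) + ell (trace [set y]) = 0)%E.
    by rewrite !length_set1 adde0.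
  exact: (measureU2 ell (m1 x) (m1 y)).
rewrite -[leRHS]adde0 -ell_length.1; apply: le_trans (leeD2l _ e2).
apply: (measureU2 ell); first exact: measurable_trace_open_segment.
exact: (measurableU _ _ (m1 x) (m1 y)).
Qed.

End LengthUpperBound.

(** * Total variation bounds the length *)

(** The coding distance is the length of the descent from [h s] to the infimum
    plus that of the ascent to [h t]. *)
Lemma coding_dist_le_TV (R : realType) (h : R -> R) (s t : R) : s <= t ->
  ((coding_dist h s t)%:E <= total_variation s t h)%E.
Proof.
move=> st; rewrite /coding_dist min_l// max_r//.
case TVE : (total_variation s t h) => [V| |]; rewrite ?leey//; last first.
  by have := total_variation_ge0 h st; rewrite TVE.
rewrite lee_fin; set m := inf _.
suff : (h s + h t - V) / 2 <= m by lra.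
apply: lb_le_inf; first by exists (h s), s => //=; rewrite in_itv/= lexx.
move=> _ [r /= + <-]; rewrite in_itv/= => /andP[sr rt].
have : ((`|h r - h s| + `|h t - h r|)%:E <= V%:E)%E.
  rewrite -TVE (total_variationD h sr rt) EFinD.
  by apply: leeD; exact: total_variation_ge.
rewrite lee_fin.
have := ler_norm (h s - h r); have := ler_norm (h t - h r).
rewrite (distrC (h s)); lra.
Qed.

Section LengthOfChains.
Context {R : realType} {T : metricType R} {rho : T}.
Hypothesis T_tree : real_tree T.
Variable ell : {measure set (skeleton_space rho) -> \bar R}.
Hypothesis ell_length : is_length_measure ell.
Local Notation trace A := (@skeleton_val _ _ rho @^-1` A).

Definition chain_links (q : nat -> T) (n : nat) : set T :=
  [set x | exists2 k, (k < n)%N & segment (q k) (q k.+1) x].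

Lemma chain_linksS q n :
  chain_links q n.+1 = chain_links q n `|` segment (q n) (q n.+1).
Proof.
rewrite eqEsubset; split=> x.
  move=> [k]; rewrite ltnS leq_eqVlt => /predU1P[->|kn kx]; first by right.
  by left; exists k.
move=> [[k kn kx]|nx]; last by exists n.
by exists k => //; rewrite ltnS ltnW.
Qed.

Lemma chain_links0 q : chain_links q 0 = set0.
Proof. by rewrite -subset0 => x []. Qed.

Lemma closed_chain_links q n : closed (chain_links q n).
Proof.
elim: n => [|n IH]; first by rewrite chain_links0; exact: closed0.
by rewrite chain_linksS; apply: closedU => //; exact: closed_segment.
Qed.

Lemma length_chain_le q n :
  (ell (trace (chain_links q n)) <= \sum_(k < n) (mdist (q k) (q k.+1))%:E)%E.
Proof.
elim: n => [|n IH].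
  by rewrite chain_links0 preimage_set0 big_ord0 measure0.
rewrite chain_linksS big_ord_recr/=.
apply: le_trans (leeD IH (length_segment_le T_tree ell_length _ _)).
apply: (measureU2 ell).
  exact/measurable_trace_closed/closed_chain_links.
exact/measurable_trace_closed/closed_segment.
Qed.

End LengthOfChains.

Section CodedTreeLength.
Context {R : realType} {T : metricType R} {rho : T}.
Variables (h : heightFun R) (p : R -> T).
Local Notation M := (hf_bound h).
Hypothesis p_surj : forall x, exists2 t, t \in `[0, M] & p t = x.
Hypothesis p_dist :
  {in `[0, M] &, forall s t, mdist (p s) (p t) = coding_dist h s t}.

Definition grid (n k : nat) : R := M * (k%:R / n.+1%:R).

Lemma grid0 n : grid n 0 = 0.
Proof. by rewrite /grid mul0r mulr0. Qed.

Lemma grid_last n : grid n n.+1 = M.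
Proof. by rewrite /grid divff ?mulr1// pnatr_eq0. Qed.

Lemma grid_le n i j : (i <= j)%N -> grid n i <= grid n j.
Proof.
move=> ij; rewrite ler_wpM2l ?hf_bound_ge0// ler_wpM2r ?invr_ge0 ?ler0n//.
by rewrite ler_nat.
Qed.

Lemma grid_itv n k : (k <= n.+1)%N -> grid n k \in `[0, M].
Proof.
move=> kn; rewrite in_itv/= -[in X in X && _](grid0 n).
by rewrite -[in X in _ && X](grid_last n) !grid_le.
Qed.

Lemma grid_dist_le_TV n k : (k <= n.+1)%N ->
  (\sum_(i < k) (mdist (p (grid n i)) (p (grid n i.+1)))%:E <=
   total_variation 0 (grid n k) h)%E.
Proof.
elim: k => [|k IH] kn.
  by rewrite big_ord0 total_variation_ge0// -(grid0 n) grid_le.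
rewrite big_ord_recr/= (@total_variationD _ _ _ (grid n k)).
- apply: leeD; first exact/IH/ltnW.
  rewrite p_dist ?grid_itv//; last exact: ltnW.
  by apply: coding_dist_le_TV; exact: grid_le.
- by rewrite -(grid0 n) grid_le.
- exact: grid_le.
Qed.

(** Left continuity of [h] makes the parametrization left continuous: just before
    [u] all the heights, hence also their infimum, are close to [h u]. *)
Lemma left_dense u e : u \in `]0, M] -> 0 < e ->
  exists2 d, 0 < d &
    forall r, 0 <= r -> u - d < r -> r <= u -> mdist (p u) (p r) < e.
Proof.
move=> uM e0; have e40 : 0 < e / 4 by rewrite divr_gt0.
have [d /= d0 dP] :=
  @cvgr_dist_lt R R _ (u^'-) _ h (h u) (hf_left_continuous uM) _ e40.
have near_h r : u - d < r -> r <= u -> `|h u - h r| < e / 4.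
  move=> ur; rewrite le_eqVlt => /predU1P[->|ru]; first by rewrite subrr normr0.
  by apply: dP => //=; rewrite gtr0_norm ?subr_gt0//; lra.
exists d => // r r0 ur ru.
move: (uM); rewrite in_itv/= => /andP[u0 uM'].
rewrite metric_sym p_dist ?in_itv/= ?r0 ?(le_trans ru)// ?(ltW u0)//.
rewrite /coding_dist min_l// max_r//; set m := inf _.
suff : h u - e / 4 <= m.
  by have := near_h r ur ru; rewrite ltr_norml => /andP[]; lra.
apply: lb_le_inf; first by exists (h u), u => //=; rewrite in_itv/= lexx ru.
move=> _ [v /= + <-]; rewrite in_itv/= => /andP[rv vu].
by have := near_h v (lt_le_trans ur rv) vu; rewrite ltr_norml => /andP[]; lra.
Qed.

(** The last time of a fine grid before a visit to [A] is close to that visit, and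
    left continuity suffices to find it in [A]. *)
Lemma grid_dense (A : set T) : open A -> A !=set0 ->
  \forall n \near \oo, exists2 k, (k <= n.+1)%N & A (p (grid n k)).
Proof.
move=> Aopen [x Ax]; have [u uM pu] := p_surj x.
move: (uM); rewrite in_itv/= => /andP[].
rewrite le_eqVlt => /predU1P[u0 _|u0 uM'].
  by apply: nearW => n; exists 0%N => //; rewrite grid0 u0 pu.
have M0 : 0 < M by exact: lt_le_trans uM'.
have /nbhs_ballP[e /= e0 eA] : nbhs x A by exact: open_nbhs_nbhs.
have [|d d0 dP] := @left_dense u e _ e0; first by rewrite in_itv/= u0.
exists (Num.truncn (M / d)) => // n /= dn.
have n0 : 0 < n.+1%:R :> R by rewrite ltr0n.
have Mn : M / n.+1%:R < d.
  rewrite ltr_pdivrMr// -ltr_pdivrMl// mulrC.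
  have /andP[_ /lt_le_trans] : (Num.truncn (M / d))%:R <= M / d <
      (Num.truncn (M / d)).+1%:R by apply: truncn_itv; rewrite divr_ge0// ltW.
  by apply; rewrite ler_nat.
pose v := u * n.+1%:R / M.
have v0 : 0 <= v by rewrite divr_ge0 ?mulr_ge0// ltW.
have uE : u = M * (v / n.+1%:R).
  by rewrite /v; field; rewrite !gt_eqF// addrC natr1.
have /andP[kv vk] : (Num.truncn v)%:R <= v < (Num.truncn v).+1%:R.
  exact: truncn_itv.
exists (Num.truncn v).
  rewrite -(@ler_nat R) (le_trans kv)// /v ler_pdivrMr// mulrC.
  by rewrite ler_wpM2l// ltW.
apply: eA; rewrite ballEmdist/= -pu; apply: dP.
- by rewrite mulr_ge0 ?divr_ge0 ?ler0n// ltW.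
- rewrite ltrBlDr; apply: (@lt_trans _ _ (grid n (Num.truncn v) + M / n.+1%:R)).
    rewrite uE /grid -mulrDr -[X in _ + X]mul1r -mulrDl natr1 ltr_pM2l//.
    by rewrite ltr_pM2r ?invr_gt0.
  by rewrite ltrD2l.
- by rewrite uE ler_wpM2l ?hf_bound_ge0// ler_wpM2r// invr_ge0 ltW.
Qed.

End CodedTreeLength.

(** The grid bound reaches the points of the skeleton other than the root, and
    the root has mass 0 by the second clause of [is_length_measure]. *)
Lemma coded_finite_length (R : realType) (T : metricType R)
    (T_tree : real_tree T) (rho : T)
    (ell : {measure set (skeleton_space rho) -> \bar R})
    (ell_length : is_length_measure ell) (h : heightFun R) :
  bounded_variation 0 (hf_bound h) h -> isometric T (coded_tree h) ->
  (ell [set: skeleton_space rho] < +oo)%E.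
Proof.
move=> hBV /isometric_coded_treeP[p [psurj pdist]].
pose S n := chain_links (fun k => p (grid h n k)) n.+1.
pose V := total_variation 0 (hf_bound h) h.
have Vfin : V \is a fin_num by apply/bounded_variationP => //; exact: hf_bound_ge0.
have mclosed (A : set T) : closed A -> measurable (@skeleton_val _ _ rho @^-1` A).
  exact: measurable_trace_closed.
have mrho : measurable (@skeleton_val _ _ rho @^-1` [set rho]).
  exact/mclosed/closed_set1.
have off_root : (ell (~` (@skeleton_val _ _ rho @^-1` [set rho])) <= V)%E.
  apply: (measure_eventually_le (F := fun n => @skeleton_val _ _ rho @^-1` S n)).
  - by move=> n; exact/mclosed/closed_chain_links.
  - exact: measurableC.
  - move=> n; apply: le_trans (length_chain_le T_tree ell_length _ _) _.
    by rewrite /V -(grid_last h n); exact: grid_dist_le_TV.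
  - move=> [x xsk] xrho.
    have [A [B [AB A0 B0]]] := skeleton_cut T_tree (set_mem xsk) xrho.
    have [Aopen Bopen _ _] := AB.
    apply: filterS2 (grid_dense psurj pdist Aopen A0)
      (grid_dense psurj pdist Bopen B0).
    by move=> n Ak Bk; exact: cut_by_chain AB Ak Bk.
apply: (@le_lt_trans _ _ V); last by rewrite ltey_eq Vfin.
have -> : [set: skeleton_space rho] = @skeleton_val _ _ rho @^-1` [set rho] `|`
    ~` (@skeleton_val _ _ rho @^-1` [set rho]) by rewrite setUCr.
apply: le_trans (measureU2 ell mrho (measurableC mrho)) _.
rewrite -[leRHS]add0e; apply: leeD => //.
by rewrite -(ell_length.2).
Qed.

Theorem proposition4p1 (R : realType) (T : metricType R)
    (T_real_tree : real_tree T) (T_compact : compact [set: T]) (rho : T)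
    (ell : {measure set (skeleton_space rho) -> \bar R})
    (ell_length : is_length_measure ell) :
  (ell [set: skeleton_space rho] < +oo)%E <->
  exists h : heightFun R,
    bounded_variation 0 (hf_bound h) h /\ isometric T (coded_tree h).
Proof.
split; first exact: finite_length_coded.
by move=> [h [hBV hiso]]; exact: coded_finite_length hBV hiso.
Qed.
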